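(* Let $\Sigma\subset\mathbb R^2$ be a damping set and $p\in[1,+\infty)$. If $$\lim_{\substack{|(x,y)|\to+\infty\\(x,y)\in\Sigma}}\min\left(\frac xy,\frac yx\right)=0,$$ then the wave equation associated with $\Sigma$ is not UGAS in $\mathsf X_p$.
   Context: Notation: $\mathbb R_+=[0,+\infty)$, $R=\begin{pmatrix}\frac1{\sqrt2}&\frac1{\sqrt2}\\-\frac1{\sqrt2}&\frac1{\sqrt2}\end{pmatrix}$ and $R\Sigma=\{R\xi:\xi\in\Sigma\}$; $|\cdot|$ is the Euclidean norm. In the minimum, a quotient with zero denominator is read as $+\infty$ (so that the minimum is $0$ when exactly one of $x,y$ vanishes). $L^p_{\mathrm{loc}}(a,+\infty)$ is the set of measurable functions whose restriction to $(a,T)$ is in $L^p$ for every $T>a$. $W^{1,p}_*(0,1)=\{u\in L^p(0,1): u'\in L^p(0,1),\ u(0)=0\}$ and $\mathsf X_p=W^{1,p}_*(0,1)\times L^p(0,1)$, with norm $\|(u,v)\|_{\mathsf X_p}^p=2^{-p/2}\int_0^1(|u'+v|^p+|u'-v|^p)\,dx$. The wave equation associated with $\Sigma$ is: $z_{tt}=z_{xx}$ on $\mathbb R_+\times[0,1]$; $z(t,0)=0$ and $(z_t(t,1),-z_x(t,1))\in\Sigma$ for $t\in\mathbb R_+$; $z(0,x)=z_0(x)$, $z_t(0,x)=z_1(x)$ for $x\in[0,1]$. A (weak, global in time) solution in $\mathsf X_p$ with initial condition $(z_0,z_1)\in\mathsf X_p$ is a function $z:\mathbb R_+\times[0,1]\to\mathbb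 R$ for which there exist $f\in L^p_{\mathrm{loc}}(0,+\infty)$ and $g\in L^p_{\mathrm{loc}}(-1,+\infty)$ such that $z(t,x)=\frac1{\sqrt2}\int_0^{t+x}f+\frac1{\sqrt2}\int_0^{t-x}g$ for all $(t,x)\in\mathbb R_+\times[0,1]$, $z(t,0)=0$ and $(z_t(t,1),-z_x(t,1))\in\Sigma$ for a.e. $t\in\mathbb R_+$, and $z(0,x)=z_0(x)$, $z_t(0,x)=z_1(x)$ for a.e. $x\in[0,1]$; here $z_t(t,x)=\frac{f(t+x)+g(t-x)}{\sqrt2}$ and $z_x(t,x)=\frac{f(t+x)-g(t-x)}{\sqrt2}$. Set $e_p(z)(t)=\|(z(t,\cdot),z_t(t,\cdot))\|_{\mathsf X_p}$. Damping set: $\Sigma$ is a damping set if $(0,0)\in\Sigma$, $xy\ge0$ for every $(x,y)\in\Sigma$, and $R\Sigma$ contains the graph of a universally measurable function $\varphi:\mathbb R\to\mathbb R$ with linear growth ($|\varphi(x)|\le a|x|+b$ for some $a,b\ge0$). A set $M\subset\mathbb R$ is universally measurable if for every Borel probability measure $\nu$ on $\mathbb R$ there exist Borel sets $A\subset M\subset B$ with $\nu(B\setminus A)=0$; $\varphi$ is universally measurable if preimages of Borel sets are universally measurable. UGAS: the wave equation is UGAS (uniformly globally asymptotically stable) in $\mathsf X_p$ if there is a $\mathcal{KL}$ function $\beta$ such that $e_p(z)(t)\le\beta(e_p(z)(0),t)$ for all $t\ge0$ and every solution $z$ in $\mathsf X_p$. A $\mathcal{KL}$ function is a continuous $\beta:\mathbb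 R_+\times\mathbb R_+\to\mathbb R_+$ such that for each $t$, $\beta(\cdot,t)$ is increasing with $\beta(0,t)=0$, and for each $x>0$, $\beta(x,\cdot)$ is decreasing and tends to $0$ at $+\infty$. *)

(* Defs.v *)
From mathcomp Require Import all_boot all_order all_algebra.
From mathcomp Require Import all_classical all_reals all_analysis.

Set Implicit Arguments.
Unset Strict Implicit.
Unset Printing Implicit Defensive.

Import Order.TTheory GRing.Theory Num.Theory.
Import numFieldNormedType.Exports.

Local Open Scope classical_set_scope.
Local Open Scope ring_scope.

Section Plane.
Context {R : realType}.
Implicit Types (xi : R * R) (x y : R) (Sigma : set (R * R)).

Definition rotation xi : R * R :=
  ((xi.1 + xi.2) / Num.sqrt 2, (- xi.1 + xi.2) / Num.sqrt 2).

(* The library norm on [R * R] is the sup norm. *)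
Definition euclidean_norm xi : R := Num.sqrt (xi.1 ^+ 2 + xi.2 ^+ 2).

(* The filter |xi| -> +oo in the plane. *)
Definition plane_infty : set_system (R * R) :=
  filter_from [set: R] (fun M => [set xi | M < euclidean_norm xi]).

(* A quotient with zero denominator is +oo. *)
Definition quotient_ereal x y : \bar R :=
  if y == 0 then +oo%E else (x / y)%:E.

Definition min_quotient xi : \bar R :=
  Order.min (quotient_ereal xi.1 xi.2) (quotient_ereal xi.2 xi.1).

(* The measurable sets of [measurableTypeR R] are the Borel sets of [R]. *)
Definition universally_measurable_set (M : set R) :=
  forall nu : probability (measurableTypeR R) R,
    exists A B : set (measurableTypeR R),
      [/\ measurable A, measurable B, A `<=` M, M `<=` B & nu (B `\` A) = 0%E].

Definition universally_measurable_fun (phi : R -> R) :=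
  forall B : set (measurableTypeR R), measurable B ->
    universally_measurable_set (phi @^-1` B).

Definition linear_growth (phi : R -> R) :=
  exists a b : R, [/\ 0 <= a, 0 <= b & forall x, `|phi x| <= a * `|x| + b].

Definition damping_set Sigma :=
  [/\ Sigma (0, 0),
      forall x y, Sigma (x, y) -> 0 <= x * y &
      exists phi : R -> R,
        [/\ universally_measurable_fun phi, linear_growth phi &
            forall x, (rotation @` Sigma) (x, phi x)]].

End Plane.

Section Wave.
Context {R : realType}.
Implicit Types (p a b t x : R) (u du v f g : R -> R) (z : R -> R -> R).
Implicit Types (Sigma : set (R * R)) (beta : R -> R -> R).

Local Notation mu := (@lebesgue_measure R).

(* The integral of f from a to b, with sign: minus the integral over [b, a]
   when b < a. *)
Definition oriented_integral a b f : R :=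
  if a <= b then \int[mu]_(s in `[a, b]) f s
  else - \int[mu]_(s in `[b, a]) f s.

(* Membership of (the class of) f in L^p(a, b); the values of f outside ]a, b[
   are irrelevant.  Measurability is Borel measurability: every class of Lebesgue
   measurable functions has a Borel representative. *)
Definition Lp_on p a b f : Prop :=
  (f \_ `]a, b[ : measurableTypeR R -> R) \in Lfun mu p%:E.

Definition Lp_loc p a f : Prop := forall T, a < T -> Lp_on p a T f.

(* phi is in C^infty_c(0, 1), extended by 0 to R. *)
Definition test_function (phi : R -> R) :=
  (forall n x, derivable (derive1n n phi) x 1) /\
  exists K : set R, [/\ compact K, K `<=` `]0, 1[ &
                        forall x, ~ K x -> phi x = 0].

(* du is the derivative of u on ]0, 1[ in the sense of distributions. *)
Definition weak_derivative u du :=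
  forall phi, test_function phi ->
    \int[mu]_(x in `]0, 1[) (u x * derive1 phi x) =
    - \int[mu]_(x in `]0, 1[) (du x * phi x).

(* u is the continuous representative of an element of W^{1,p}_*(0, 1), and du
   is a representative of its derivative. *)
Definition W1p_star p u du :=
  [/\ Lp_on p 0 1 u, Lp_on p 0 1 du, weak_derivative u du,
      {within `[0, 1], continuous u} & u 0 = 0].

Definition Xp p u v := (exists du, W1p_star p u du) /\ Lp_on p 0 1 v.

(* n is the norm of (u, v) in X_p.  The derivative of u is only defined almost
   everywhere, so that the norm is given as a functional relation. *)
Definition Xp_norm p u v (n : R) :=
  exists du, [/\ W1p_star p u du, Lp_on p 0 1 v &
    n = (2 `^ (- (p / 2)) *
         \int[mu]_(x in `]0, 1[)
            (`|du x + v x| `^ p + `|du x - v x| `^ p)) `^ p^-1].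

Definition wave f g t x : R :=
  (Num.sqrt 2)^-1 * oriented_integral 0 (t + x) f +
  (Num.sqrt 2)^-1 * oriented_integral 0 (t - x) g.

Definition wave_t f g t x : R := (f (t + x) + g (t - x)) / Num.sqrt 2.

Definition wave_x f g t x : R := (f (t + x) - g (t - x)) / Num.sqrt 2.

(* z is the solution given by f and g.  The functions f and g are determined by
   z up to null sets; they are kept as parameters because z_t and z_x are
   defined through them. *)
Definition solution_from Sigma p (z0 z1 : R -> R) z f g :=
  [/\ Lp_loc p 0 f /\ Lp_loc p (-1) g,
      forall t x, 0 <= t -> 0 <= x <= 1 -> z t x = wave f g t x,
      {ae mu, forall t, 0 <= t ->
         z t 0 = 0 /\ Sigma (wave_t f g t 1, - wave_x f g t 1)} &
      {ae mu, forall x, 0 <= x <= 1 ->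
         z 0 x = z0 x /\ wave_t f g 0 x = z1 x}].

Definition class_KL beta :=
  [/\ forall x t, 0 <= x -> 0 <= t -> 0 <= beta x t,
      {within [set q : R * R | 0 <= q.1 /\ 0 <= q.2],
         continuous (fun q : R * R => beta q.1 q.2)},
      forall t, 0 <= t ->
        beta 0 t = 0 /\
        (forall x y, 0 <= x -> x < y -> beta x t < beta y t) &
      forall x, 0 < x ->
        (forall s t : R, 0 <= s -> s < t -> beta x t < beta x s) /\
        beta x t @[t --> +oo] --> 0].

(* e0 and e are the values e_p(z)(0) and e_p(z)(t). *)
Definition UGAS Sigma p :=
  exists beta, class_KL beta /\
    forall (z0 z1 : R -> R) z f g,
      Xp p z0 z1 -> solution_from Sigma p z0 z1 z f g ->
      forall t e0 e, 0 <= t ->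
        Xp_norm p (z 0) (wave_t f g 0) e0 ->
        Xp_norm p (z t) (wave_t f g t) e ->
        e <= beta e0 t.

End Wave.

(* Main.v *)
Require Import Defs.
From mathcomp Require Import all_boot all_order all_algebra.
From mathcomp Require Import all_classical all_reals all_analysis.
From mathcomp Require Import measurable_realfun ring lra.

Import Order.TTheory GRing.Theory Num.Theory.
Import numFieldNormedType.Exports.

Local Open Scope classical_set_scope.
Local Open Scope ring_scope.

(** A solution with z(t, 0) = 0 has f = - g, and the boundary condition at
x = 1 says that (g(t - 1), g(t + 1)) lies on the rotated set.  So a function
phi whose graph lies in the rotated set gives solutions through the recursion
g(s + 2) = phi(g(s)), and the norm at time t is the L^p norm of g on
[t - 1, t + 1].

The damping condition reads |phi(a)| <= |a|.  When x/y or y/x is small, x + y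
and y - x have almost the same absolute value, so the limit hypothesis says
that |phi(a)| / |a| tends to 1 as |a| tends to infinity
([graph_norm_ge]).  For a fixed n, the same holds for the n-th iterate of phi
([iter_norm_ge]): large values are hardly damped during n periods.

Under UGAS some time t = 2 N would satisfy beta(1, t) < 1/2.  Take for the
initial g a single pulse of height c on an interval of length h = c^(-p): its
norm is 1.  One period later the height of the pulse has become phi(c), and at
time 2 N the norm is |phi^N(c)| h^(1/p) = |phi^N(c)| / c, which is at least
1/2 once c is large.  This contradicts the choice of N.

The pulses are placed just before the even times ([pulse_train]), so that at
an even time the whole state (z, z_t) is explicit: z is, up to a factor, the
ramp min(x, h) and z_t is minus its derivative.  The weak derivative of the
ramp is computed by parts ([ramp_by_parts]), which gives the membership in the
energy space and the norm ([ramp_Xp_norm]). *)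

(** * Weak damping of large values *)

Section Iterates.
Context {R : realType}.
Implicit Types (Sigma : set (R * R)) (phi : R -> R).

Lemma unrotate Sigma (a b : R) : (rotation @` Sigma) (a, b) ->
  Sigma ((a - b) / Num.sqrt 2, (a + b) / Num.sqrt 2).
Proof.
case=> -[x y] Sxy [<- <-] /=.
have s22 : (Num.sqrt 2 : R)^-1 * (Num.sqrt 2)^-1 = 2^-1.
  by rewrite -invfM -expr2 sqr_sqrtr.
rewrite -mulrBl -mulrDl -!mulrA !s22.
rewrite (_ : (x + y - (- x + y)) / 2 = x); last by field.
by rewrite (_ : (x + y + (- x + y)) / 2 = y)//; field.
Qed.

(** In the rotated coordinates x y = (a^2 - phi(a)^2) / 2. *)
Lemma graph_norm_le phi Sigma :
  (forall x y, Sigma (x, y) -> 0 <= x * y) ->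
  (forall a, (rotation @` Sigma) (a, phi a)) ->
  forall a, `|phi a| <= `|a|.
Proof.
move=> hpos hphi a; have /unrotate/hpos := hphi a.
rewrite mulrACA -invfM -expr2 sqr_sqrtr// pmulr_lge0 ?invr_gt0//.
rewrite -subr_sqr subr_ge0 -[X in _ <= X -> _]real_normK ?num_real//.
rewrite -[X in X <= _ -> _]real_normK ?num_real//.
by rewrite ler_sqr.
Qed.

(** Up to exchanging x and y, x = r y with 0 <= r < (1 - q) / 2, and the claim
becomes q (1 + r) <= |1 - r|. *)
Lemma quotient_norm_ge (q x y : R) : q < 1 -> 0 <= x * y ->
  (min_quotient (x, y) < ((1 - q) / 2)%:E)%E -> q * `|x + y| <= `|y - x|.
Proof.
have aux u v : q < 1 -> 0 <= u * v ->
    (quotient_ereal u v < ((1 - q) / 2)%:E)%E -> q * `|u + v| <= `|v - u|.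
  move=> q1 uv0; rewrite /quotient_ereal; case: eqP => [//|/eqP v0].
  rewrite lte_fin => uv.
  have v2 : 0 < v ^+ 2 by rewrite exprn_even_gt0.
  have uvge : 0 <= u / v.
    by rewrite -(pmulr_rge0 _ v2) mulrC expr2 mulrA divfK.
  rewrite -(divfK v0 u); set r := u / v in uv uvge *.
  have -> : v - r * v = (1 - r) * v by ring.
  have -> : r * v + v = (1 + r) * v by ring.
  rewrite !normrM mulrA ler_wpM2r// (ger0_norm (_ : 0 <= 1 + r)); last lra.
  have [q0|q0] := leP q 0.
    by apply: (@le_trans _ _ 0); rewrite // mulr_le0_ge0// addr_ge0.
  apply: le_trans (ler_norm _).
  (* q (1 + r) <= 1 - r, because r (1 + q) <= (1 - q) (1 + q) / 2 <= 1 - q *)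
  have : r * (1 + q) <= (1 - q) / 2 * (1 + q).
    by rewrite ler_wpM2r ?(ltW uv)//; lra.
  have : (1 - q) * (1 + q) <= (1 - q) * 2 by rewrite ler_wpM2l//; lra.
  lra.
move=> q1 xy0; rewrite /min_quotient gt_min => /orP[] /=; first exact: aux.
by rewrite [x + y]addrC distrC; apply: aux; rewrite // mulrC.
Qed.

(** The point of Sigma that the rotation sends to (a, phi(a)) has norm at least
|a|, so its quotient is small when |a| is large. *)
Lemma graph_norm_ge phi Sigma :
  (forall x y, Sigma (x, y) -> 0 <= x * y) ->
  (forall a, (rotation @` Sigma) (a, phi a)) ->
  min_quotient xi @[xi --> within Sigma plane_infty] --> (0 : R)%:E ->
  forall q, q < 1 -> exists M, forall a, M < `|a| -> q * `|a| <= `|phi a|.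
Proof.
move=> hpos hphi hlim q q1.
have q2 : (0 : R) < (1 - q) / 2 by lra.
have [M _ hM] : within Sigma plane_infty
    (fun xi => (min_quotient xi < ((1 - q) / 2)%:E)%E).
  apply: (hlim [set e | (e < ((1 - q) / 2)%:E)%E]).
  by apply: open_nbhs_nbhs; split; [exact: open_ereal_lt_ereal | rewrite /= lte_fin].
exists M => a Ma; have Sa := unrotate _ _ _ (hphi a).
set x := (a - _) / _ in Sa; set y := (a + _) / _ in Sa.
have s2 : (0 : R) < Num.sqrt 2 by rewrite sqrtr_gt0.
have s22 : (Num.sqrt 2 : R) ^+ 2 = 2 by rewrite sqr_sqrtr.
have : (min_quotient (x, y) < ((1 - q) / 2)%:E)%E.
  apply: hM => //=; apply: (lt_le_trans Ma).
  rewrite /euclidean_norm -sqrtr_sqr /=; apply: ler_wsqrtr.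
  rewrite /x /y !expr_div_n s22.
  have := sqr_ge0 (phi a); lra.
move/(quotient_norm_ge _ _ _ q1 (hpos _ _ Sa)).
have -> : x + y = a * (2 / Num.sqrt 2) by rewrite /x /y; ring.
have -> : y - x = phi a * (2 / Num.sqrt 2) by rewrite /x /y; ring.
have : 0 < `|2 / Num.sqrt 2 : R| by rewrite normr_gt0 gt_eqF// divr_gt0.
by move: (2 / _) => k k0; rewrite !normrM mulrA ler_pM2r.
Qed.

(** One step costs the factor r = (1 + q) / 2, and r^2 >= q; since r >= 1/2,
asking |a| > 2 M1 keeps the n-th iterate above the threshold M1 of one step. *)
Lemma iter_norm_ge phi :
  (forall q, q < 1 -> exists M, forall a, M < `|a| -> q * `|a| <= `|phi a|) ->
  forall n q, q < 1 ->
    exists M, forall a, M < `|a| -> q * `|a| <= `|iter n phi a|.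
Proof.
move=> hphi; elim=> [|n IHn] q q1.
  by exists 0 => a _; rewrite ler_piMl// ltW.
wlog q0 : q q1 / 0 <= q => [hw|].
  have [|q0] := leP 0 q; first exact: hw.
  by exists 0 => a _; apply: (@le_trans _ _ 0); rewrite ?mulr_le0_ge0// ltW.
pose r := (1 + q) / 2; have r1 : r < 1 by rewrite /r; lra.
have [M1 hM1] := hphi r r1; have [M2 hM2] := IHn r r1.
exists (Num.max M2 (2 * M1)) => a; rewrite gt_max => /andP[aM2 aM1].
have := hM2 _ aM2 => ra.
apply: le_trans (hM1 _ _); last first.
  apply: lt_le_trans ra.
  have : 2^-1 * `|a| <= r * `|a| by rewrite ler_wpM2r// /r; lra.
  lra.
apply: (@le_trans _ _ (r * (r * `|a|))); last by rewrite ler_wpM2l// /r; lra.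
rewrite mulrA ler_wpM2r// /r; have := sqr_ge0 (1 - q); lra.
Qed.

End Iterates.

(** * Intervals and oriented integrals *)

Section Integrals.
Context {R : realType}.
Implicit Types (p a b c : R) (f : R -> R).
Local Notation mu := (@lebesgue_measure R).

Lemma bounded_integrable a b c f : measurable_fun `[a, b] f ->
  (forall x, x \in `[a, b] -> `|f x| <= c) -> mu.-integrable `[a, b] (EFin \o f).
Proof.
move=> mf fc; apply: measurable_bounded_integrable => //.
  by rewrite /= lebesgue_measure_itv/=; case: ifP => _; rewrite ?ltry.
exists c; split; first exact: num_real.
by move=> y cy x /fc fx; apply: le_trans fx (ltW cy).
Qed.

Lemma Lp_on_bounded p a b c f : 0 < p -> measurable_fun `]a, b[ f ->
  (forall x, x \in `]a, b[ -> `|f x| <= c) -> Lp_on p a b f.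
Proof.
move=> p0 mf fc; rewrite /Lp_on inE /=.
have mfr : measurable_fun setT (f \_ `]a, b[).
  by move/(measurable_restrictT f (measurable_itv _)): mf.
apply/andP; split; rewrite inE/=; first exact: mfr.
rewrite /finite_norm unlock; apply: poweR_lty.
have c0 x : x \in `]a, b[ -> 0 <= c by move/fc; apply: le_trans.
apply: (@le_lt_trans _ _ (\int[mu]_(x in `]a, b[) (c `^ p)%:E)%E).
  rewrite [leRHS]integral_mkcond; apply: ge0_le_integral => //=.
  - apply/measurable_EFinP; apply: (measurableT_comp (measurable_powR p)).
    exact: measurableT_comp mfr.
  - by apply/(measurable_restrictT _ _).1 => //.
  - move=> x _; rewrite !patchE; case: ifPn => [|_] /=.
      rewrite inE => /= xab; rewrite lee_fin.
      by rewrite ge0_ler_powR ?nnegrE ?(ltW p0) ?(c0 x) ?normr_ge0 ?fc.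
    by rewrite normr0 powR0 ?gt_eqF.
rewrite integral_cst//= lebesgue_measure_itv/=; case: ifP => _.
  by rewrite -EFinD -EFinM ltry.
by rewrite mule0 ltry.
Qed.

Lemma Rintegral_itv_cat a b c f : a <= b <= c ->
  mu.-integrable `[a, c] (EFin \o f) ->
  \int[mu]_(s in `[a, c]) f s =
  \int[mu]_(s in `[a, b]) f s + \int[mu]_(s in `[b, c]) f s.
Proof.
move=> /andP[ab bc] fi.
rewrite -[X in _ + X]Rintegral_itv_obnd_cbnd; last first.
  by apply: integrableS fi => //; apply: subset_itvr; rewrite bnd_simp.
rewrite -(@Rintegral_itvB _ f (BLeft a) (BRight c) b)// ?bnd_simp//.
by rewrite addrC subrK.
Qed.

Lemma oriented_integralB (m M : R) a b f :
  mu.-integrable `[m, M] (EFin \o f) ->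
  m <= 0 <= M -> m <= a -> a <= b -> b <= M ->
  oriented_integral 0 b f - oriented_integral 0 a f =
  \int[mu]_(s in `[a, b]) f s.
Proof.
move=> fi /andP[m0 M0] ma ab bM.
have fiS x y : m <= x -> y <= M -> mu.-integrable `[x, y] (EFin \o f).
  by move=> mx yM; apply: integrableS fi => //; apply: subset_itv; rewrite bnd_simp.
rewrite /oriented_integral; have [a0|a0] := leP 0 a.
  rewrite (le_trans a0 ab) (@Rintegral_itv_cat 0 a b)// ?a0//; last exact: fiS.
  by rewrite addrAC subrr add0r.
have [b0|b0] := leP 0 b.
  rewrite opprK addrC (@Rintegral_itv_cat a 0 b)// ?b0 ?ltW//; exact: fiS.
rewrite opprK addrC (@Rintegral_itv_cat a b 0)// ?ab ?(ltW b0)//.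
  by rewrite addrK.
exact: fiS.
Qed.

End Integrals.

(** * Weak derivative of the ramp *)

Section TestFunctions.
Context {R : realType}.
Implicit Types (p a b c h : R) (f u du v : R -> R).
Local Notation mu := (@lebesgue_measure R).

Lemma test_function_derivable (phi : R -> R) n : test_function phi ->
  forall x, derivable (derive1n n phi) x 1.
Proof. by case. Qed.

Lemma test_function_continuous (phi : R -> R) n : test_function phi ->
  continuous (derive1n n phi).
Proof.
move=> tphi x; apply/differentiable_continuous/derivable1_diffP.
exact: test_function_derivable.
Qed.

Lemma test_function_ends (phi : R -> R) : test_function phi ->
  phi 0 = 0 /\ phi 1 = 0.
Proof.
by case=> _ [K [_ K01 K0]]; split; apply: K0 => /K01; rewrite /= in_itv/= ltxx ?andbF.
Qed.

Lemma everywhere_derivable_oo (f : R -> R) a b :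
  (forall x, derivable f x 1) -> derivable_oo_LRcontinuous f a b.
Proof.
move=> df; have cf x : {for x, continuous f}.
  exact/differentiable_continuous/derivable1_diffP.
by split=> [x _ //||]; [apply: cvg_at_right_filter|apply: cvg_at_left_filter]; exact: cf.
Qed.

Lemma continuous_itv_integrable f a b : continuous f ->
  mu.-integrable `[a, b] (EFin \o f).
Proof.
move=> cf; apply: continuous_compact_integrable; first exact: segment_compact.
exact: continuous_subspaceT.
Qed.

Lemma continuous_ramp h : continuous (fun x => Num.min x h).
Proof.
by move=> x; apply: (@continuous_min _ _ id (cst h)); [exact: cvg_id|exact: cvg_cst].
Qed.

(** On [0, h] the ramp is x and an integration by parts gives the boundary term
h phi(h); on [h, 1] it is the constant h, and h (phi(1) - phi(h)) cancels this
term because phi(1) = 0. *)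
Lemma ramp_by_parts h (phi : R -> R) : test_function phi -> 0 < h -> h < 1 ->
  \int[mu]_(x in `[0, 1]) (Num.min x h * derive1 phi x) =
  - \int[mu]_(x in `[0, h]) phi x.
Proof.
move=> tphi h0 h1.
have cphi : continuous phi := test_function_continuous phi 0 tphi.
have cdphi : continuous (derive1 phi) := test_function_continuous phi 1 tphi.
have dphi := test_function_derivable phi 0 tphi.
have [phi0 phi1] := test_function_ends phi tphi.
rewrite (Rintegral_itv_cat 0 h 1) ?(ltW h0) ?(ltW h1)//; last first.
  apply: (continuous_itv_integrable (fun x => Num.min x h * derive1 phi x)) => x.
  apply: (@continuousM _ _ (fun x => Num.min x h) (derive1 phi)); last exact: cdphi.
  exact: continuous_ramp.
have -> : \int[mu]_(x in `[0, h]) (Num.min x h * derive1 phi x) =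
    \int[mu]_(x in `[0, h]) (x * derive1 phi x).
  apply: eq_Rintegral => x; rewrite inE /= in_itv/= => /andP[_ xh].
  by rewrite (min_idPl xh).
have -> : \int[mu]_(x in `[h, 1]) (Num.min x h * derive1 phi x) =
    \int[mu]_(x in `[h, 1]) (h * derive1 phi x).
  apply: eq_Rintegral => x; rewrite inE /= in_itv/= => /andP[xh _].
  by rewrite (min_idPr xh).
rewrite RintegralZl//; last exact: continuous_itv_integrable.
have -> : \int[mu]_(x in `[h, 1]) derive1 phi x = phi 1 - phi h.
  rewrite /Rintegral (@continuous_FTC2 _ (derive1 phi) phi)//.
  - exact: continuous_subspaceT.
  - exact: everywhere_derivable_oo.
rewrite (@Rintegration_by_parts _ id phi (cst 1) (derive1 phi))//.
- rewrite phi1 mul0r subr0 sub0r mulrN addrC addKr.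
  by under eq_Rintegral do rewrite mul1r.
- by apply: continuous_subspaceT => x; exact: cvg_cst.
- by apply: everywhere_derivable_oo => x; exact: derivable_id.
- by move=> x _; rewrite derive1_id.
- exact: continuous_subspaceT.
- exact: everywhere_derivable_oo.
Qed.

End TestFunctions.

(** * The norm of a ramp *)

Section Ramp.
Context {R : realType}.
Implicit Types (p a b c h : R) (f u du v : R -> R).
Local Notation mu := (@lebesgue_measure R).

Lemma measurable_step a h : measurable_fun setT (fun x : R => if x <= h then a else 0).
Proof.
apply: measurable_fun_ifT => //; exact: measurable_fun_ler.
Qed.

Lemma Rintegral_itv_oo_cc a b f : mu.-integrable `[a, b] (EFin \o f) ->
  \int[mu]_(x in `]a, b[) f x = \int[mu]_(x in `[a, b]) f x.
Proof.
move=> fi; rewrite Rintegral_itv_obnd_cbnd; last first.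
  by apply: integrableS fi => //; exact: subset_itv_oo_cc.
rewrite Rintegral_itv_bndo_bndc//.
by apply: integrableS fi => //; exact: subset_itv_co_cc.
Qed.

Lemma Rintegral_step h f : h < 1 ->
  \int[mu]_(x in `]0, 1[) (if x <= h then f x else 0) =
  \int[mu]_(x in `]0, h]) f x.
Proof.
move=> h1; have -> : [set` `]0, h]] = [set` `]0, 1[] `&` [set x : R | x <= h].
  apply/seteqP; split=> x /=; rewrite !in_itv/=.
    by move=> /andP[x0 xh]; rewrite x0 xh (le_lt_trans xh).
  by move=> [/andP[x0 _] xh]; rewrite x0 xh.
rewrite Rintegral_mkcondr; apply: eq_Rintegral => x _.
rewrite patchE (_ : (x \in [set y | y <= h]) = (x <= h))//.
by apply/idP/idP; rewrite inE.
Qed.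

Lemma Lp_on_step p a h f : 0 < p ->
  {in `]0, 1[, forall x, f x = if x <= h then a else 0} -> Lp_on p 0 1 f.
Proof.
move=> p0 fE; apply: (Lp_on_bounded p 0 1 `|a|) => //.
  apply: (eq_measurable_fun (fun x : R => if x <= h then a else 0)).
    by move=> x; rewrite inE /= => /fE.
  apply: measurable_funTS; exact: measurable_step.
by move=> x /fE ->; case: ifP; rewrite ?normr0.
Qed.

Lemma ramp_W1p_star p a h u du : 0 < p -> 0 < h -> h < 1 ->
  {in `[0, 1], forall x, u x = a * Num.min x h} ->
  {in `]0, 1[, forall x, du x = if x <= h then a else 0} ->
  W1p_star p u du.
Proof.
move=> p0 h0 h1 uE duE.
have cr : continuous (fun x => a * Num.min x h).
  move=> x; apply: (@continuousM _ _ (cst a) (fun x => Num.min x h)).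
    exact: cvg_cst.
  exact: continuous_ramp.
have sub01 : {subset `]0, 1[ <= `[0, 1 : R]} by exact: subset_itv_oo_cc.
split.
- apply: (Lp_on_bounded p 0 1 (`|a| * h)) => //.
    apply: (eq_measurable_fun (fun x : R => a * Num.min x h)).
      by move=> x; rewrite inE /= => /sub01/uE.
    by apply: measurable_funTS; exact: continuous_measurable_fun.
  move=> x x01; rewrite uE ?sub01// normrM ler_wpM2l//.
  move: x01; rewrite in_itv/= => /andP[x0 _].
  rewrite ger0_norm; first by rewrite ge_min lexx orbT.
  by rewrite le_min !ltW.
- exact: (Lp_on_step _ _ _ _ p0 duE).
- move=> phi tphi.
  have cphi := test_function_continuous phi 0 tphi.
  have cdphi := test_function_continuous phi 1 tphi.
  have cI : continuous (fun x => Num.min x h * derive1 phi x).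
    move=> x; apply: (@continuousM _ _ (fun x => Num.min x h) (derive1 phi)).
      exact: continuous_ramp.
    exact: cdphi.
  transitivity (a * \int[mu]_(x in `[0, 1]) (Num.min x h * derive1 phi x)).
    rewrite -RintegralZl//; last exact: continuous_itv_integrable.
    rewrite -Rintegral_itv_oo_cc; last first.
      apply: continuous_itv_integrable => x.
      exact: (@continuousM _ _ (cst a) _ x (cvg_cst _) (cI x)).
    by apply: eq_Rintegral => x; rewrite inE /= => /sub01/uE ->; rewrite mulrA.
  rewrite ramp_by_parts// mulrN; congr (- _).
  rewrite -RintegralZl//; last exact: continuous_itv_integrable.
  rewrite -Rintegral_itv_obnd_cbnd; last first.
    apply: integrableS
      (continuous_itv_integrable _ 0 h (_ : continuous (fun x => a * phi x))) => //.
      exact: subset_itv_oc_cc.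
    by move=> x; exact: (@continuousM _ _ (cst a) _ x (cvg_cst _) (cphi x)).
  rewrite -Rintegral_step//; apply: eq_Rintegral => x.
  by rewrite inE /= => /duE ->; case: ifP => _; rewrite ?mul0r.
- apply: (@subspace_eq_continuous _ _ _ (fun x => a * Num.min x h)).
    by move=> x; rewrite inE /= => /uE.
  exact: continuous_subspaceT.
- by rewrite uE ?bound_itvE// min_l ?mulr0// ltW.
Qed.

(** With v = - u' only u' - v = 2 u' contributes to the norm: this is a wave
that moves in one direction. *)
Lemma ramp_Xp_norm p a h u du v : 1 <= p -> 0 < h -> h < 1 ->
  {in `[0, 1], forall x, u x = a * Num.min x h} ->
  {in `]0, 1[, forall x, du x = if x <= h then a else 0} ->
  {in `]0, 1[, forall x, v x = - du x} ->
  Xp_norm p u v (Num.sqrt 2 * `|a| * h `^ p^-1).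
Proof.
move=> p1 h0 h1 uE duE vE; have p0 : 0 < p := lt_le_trans ltr01 p1.
exists du; split; first exact: (ramp_W1p_star p a h).
  apply: (Lp_on_step p (- a) h) => // x x01; rewrite vE// duE//.
  by case: ifP => _; rewrite ?oppr0.
have -> : \int[mu]_(x in `]0, 1[) (`|du x + v x| `^ p + `|du x - v x| `^ p) =
    (2 * `|a|) `^ p * h.
  transitivity (\int[mu]_(x in `]0, 1[) (if x <= h then (2 * `|a|) `^ p else 0)).
    apply: eq_Rintegral => x; rewrite inE /= => x01.
    rewrite vE// subrr normr0 powR0 ?gt_eqF// add0r opprK -mulr2n -(mulr_natl (du x) 2).
    rewrite duE// normrM ger0_norm//; case: ifP => // _.
    by rewrite normr0 mulr0 powR0// gt_eqF.
  rewrite (Rintegral_step h (cst _))// Rintegral_cst//= lebesgue_measure_itv/=.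
  by rewrite lte_fin h0 -EFinD subr0.
rewrite !powRM ?powR_ge0 ?mulr_ge0// ?(ltW h0)// -!powRrM.
have pp : p * p^-1 = 1 by rewrite mulfV// gt_eqF.
rewrite !pp !powRr1// mulNr [p / 2 / p]mulrAC pp mul1r powRN powR12_sqrt//.
have s22 : (Num.sqrt 2 : R) ^+ 2 = 2 by rewrite sqr_sqrtr.
rewrite !mulrA; congr (_ * _ * _).
by rewrite -[X in _ = _ * X]s22 expr2 mulKf// gt_eqF// sqrtr_gt0.
Qed.

End Ramp.

(** * Pulse trains *)

Section Pulses.
Context {R : realType}.
Implicit Types (a : nat -> R) (h s t x c : R) (n : nat).
Local Notation mu := (@lebesgue_measure R).

(** For s >= -1 the truncation selects the n with 2 n - 1 <= s < 2 n + 1.  The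
n-th pulse ends at 2 n, in the middle of this window, so that the state at time
2 n, which depends on the window only, contains exactly one pulse. *)
Definition pulse_train a h s : R :=
  let n := Num.truncn ((s + 1) / 2) in
  if (2 * n%:R - h <= s) && (s <= 2 * n%:R) then a n else 0.

(** The window is closed at 2 n + 1, where the truncation already selects the
next pulse: this pulse has not begun, because h < 1. *)
Lemma pulse_train_window a h n s : h < 1 ->
  2 * n%:R - 1 <= s <= 2 * n%:R + 1 ->
  pulse_train a h s =
  if (2 * n%:R - h <= s) && (s <= 2 * n%:R) then a n else 0.
Proof.
move=> h1 /andP[sl]; rewrite le_eqVlt => /predU1P[->|su].
  rewrite /pulse_train (@truncn_def _ _ n.+1); last first.
    by rewrite -[n.+2%:R]natr1 -[n.+1%:R]natr1; lra.
  rewrite -[n.+1%:R]natr1 ifF; last lra.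
  by rewrite ifF//; lra.
by rewrite /pulse_train (@truncn_def _ _ n)// -[n.+1%:R]natr1; lra.
Qed.

Lemma pulse_train_shift a h (phi : R -> R) s : phi 0 = 0 ->
  (forall n, a n.+1 = phi (a n)) -> - 1 <= s ->
  pulse_train a h (s + 2) = phi (pulse_train a h s).
Proof.
move=> phi0 aS s1; rewrite /pulse_train.
set m := Num.truncn ((s + 1) / 2).
have s0 : 0 <= (s + 1) / 2 by lra.
have /andP[ml mu_] : m%:R <= (s + 1) / 2 < m.+1%:R by exact: truncn_itv.
rewrite (@truncn_def _ _ m.+1); last first.
  by move: mu_; rewrite -[m.+2%:R]natr1 -[m.+1%:R]natr1; lra.
rewrite /= -[m.+1%:R]natr1.
have -> : (2 * (m%:R + 1) - h <= s + 2) = (2 * m%:R - h <= s) by apply/idP/idP; lra.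
have -> : (s + 2 <= 2 * (m%:R + 1)) = (s <= 2 * m%:R) by apply/idP/idP; lra.
by case: ifP.
Qed.

Lemma pulse_train_bounded a h c s : (forall n, `|a n| <= c) ->
  `|pulse_train a h s| <= c.
Proof.
move=> ac; rewrite /pulse_train; case: ifP => _ //.
by rewrite normr0 (le_trans _ (ac 0)).
Qed.

(** The windows [2 n - 1, 2 n + 1] cover [-1, +oo[, and the function is a step
function on each of them. *)
Lemma measurable_pulse_train a h : h < 1 ->
  measurable_fun (`[(- 1 : R), +oo[ : set R) (pulse_train a h).
Proof.
move=> h1.
have -> : [set` `[- 1, +oo[] =
    \bigcup_n [set` `[2 * n%:R - 1 : R, 2 * n%:R + 1]].
  apply/seteqP; split=> s /=; rewrite in_itv/= andbT.
    move=> s1; exists (Num.truncn ((s + 1) / 2)) => //=.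
    have s0 : 0 <= (s + 1) / 2 by lra.
    have := truncn_itv s0; rewrite -[(Num.truncn _).+1%:R]natr1 in_itv/=; lra.
  move=> [n _] /=; rewrite in_itv/= => /andP[ns _]; apply: le_trans ns.
  have : (0 : R) <= n%:R by []; lra.
apply/measurable_fun_bigcup => n //.
apply: (eq_measurable_fun (fun s : R =>
    if (2 * n%:R - h <= s) && (s <= 2 * n%:R) then a n else 0)).
  by move=> s; rewrite inE /= in_itv/= => sn; rewrite (pulse_train_window a h n).
apply: measurable_funTS; apply: measurable_fun_ifT => //.
by apply: measurable_and => //; exact: measurable_fun_ler.
Qed.

Lemma pulse_train_integrable a h c b1 b2 : h < 1 -> (forall n, `|a n| <= c) ->
  - 1 <= b1 -> mu.-integrable `[b1, b2] (EFin \o pulse_train a h).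
Proof.
move=> h1 ac b11; apply: (bounded_integrable _ _ c).
  apply: measurable_funS (measurable_pulse_train a h h1) => //.
  by apply: subset_itv; rewrite bnd_simp.
by move=> s _; exact: pulse_train_bounded.
Qed.

Lemma oriented_integralN (b1 : R) (f : R -> R) :
  (forall x y, - 1 <= x -> mu.-integrable `[x, y] (EFin \o f)) -> - 1 <= b1 ->
  oriented_integral 0 b1 (fun s => - f s) = - oriented_integral 0 b1 f.
Proof.
move=> fi b1N.
have iN x y : - 1 <= x -> \int[mu]_(s in `[x, y]) (- f s) = - \int[mu]_(s in `[x, y]) f s.
  move=> x1; rewrite -[RHS]mulN1r -RintegralZl//; last exact: fi.
  by apply: eq_Rintegral => s _; rewrite mulN1r.
by rewrite /oriented_integral; case: ifP => _; rewrite iN// ?lerN10.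
Qed.

(** When f = - g, the two travelling waves combine into a single integral over
the interval of dependence. *)
Lemma wave_odd (g : R -> R) t x :
  (forall x y, - 1 <= x -> mu.-integrable `[x, y] (EFin \o g)) ->
  0 <= t -> 0 <= x <= 1 ->
  wave (fun s => - g s) g t x =
  - (Num.sqrt 2)^-1 * \int[mu]_(s in `[t - x, t + x]) g s.
Proof.
move=> gi t0 /andP[x0 x1].
rewrite /wave oriented_integralN//; last lra.
rewrite -(oriented_integralB (- 1) (t + x) (t - x) (t + x)) ?gi//; [ring|lra..].
Qed.

(** The interval [2 n - x, 2 n + x] meets the n-th pulse in an interval of length
min(x, h). *)
Lemma pulse_train_integral a h n x : 0 < h -> h < 1 -> 0 <= x <= 1 ->
  \int[mu]_(s in `[2 * n%:R - x, 2 * n%:R + x]) pulse_train a h s =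
  a n * Num.min x h.
Proof.
move=> h0 h1 /andP[x0 x1].
transitivity (\int[mu]_(s in `[2 * n%:R - x, 2 * n%:R + x])
    ((cst (a n)) \_ `[2 * n%:R - h, 2 * n%:R]) s).
  apply: eq_Rintegral => s; rewrite inE/= in_itv/= => /andP[sl su].
  rewrite (pulse_train_window a h n)//; last lra.
  rewrite patchE (_ : (s \in _) = (2 * n%:R - h <= s) && (s <= 2 * n%:R))//.
  by apply/idP/idP; rewrite inE/= in_itv/=.
rewrite -Rintegral_mkcondr.
have -> : [set` `[2 * n%:R - x, 2 * n%:R + x]] `&` [set` `[2 * n%:R - h, 2 * n%:R]] =
   [set` `[2 * n%:R - Num.min x h, 2 * n%:R]].
  apply/seteqP; split=> s /=; rewrite !in_itv/=.
    move=> [/andP[? ?] /andP[? ->]]; rewrite andbT lerBlDr -lerBlDl le_min.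
    by apply/andP; split; lra.
  rewrite andbC lerBlDr -lerBlDl le_min => /and3P[? ? ?].
  by split; apply/andP; split; lra.
have m0 : 0 <= Num.min x h by rewrite le_min x0 ltW.
rewrite Rintegral_cst//= lebesgue_measure_itv/= lte_fin.
case: ifPn => [_|]; first by rewrite -EFinD/=; congr (_ * _); ring.
rewrite -leNgt => m1; suff -> : Num.min x h = 0 by [].
by apply/eqP; rewrite eq_le m0 andbT; lra.
Qed.

End Pulses.

(** * The solutions carried by pulse trains *)

Section Solution.
Context {R : realType}.
Implicit Types (a : nat -> R) (h s t x p c : R) (n : nat).
Local Notation mu := (@lebesgue_measure R).

(** At time 2 n the pulse is seen through g only: the reflected part f vanishes
on ]2 n, 2 n + 1[. *)
Lemma pulse_train_norm p a h c n : 1 <= p -> 0 < h -> h < 1 ->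
  (forall n, `|a n| <= c) ->
  let g := pulse_train a h in
  let f := fun s => - g s in
  Xp_norm p (wave f g (2 * n%:R)) (wave_t f g (2 * n%:R)) (`|a n| * h `^ p^-1).
Proof.
move=> p1 h0 h1 ac g f; have s2 : (0 : R) < Num.sqrt 2 by rewrite sqrtr_gt0.
have -> : `|a n| * h `^ p^-1 =
    Num.sqrt 2 * `|- (a n / Num.sqrt 2)| * h `^ p^-1.
  rewrite normrN normrM (ger0_norm (_ : 0 <= (Num.sqrt 2)^-1)) ?invr_ge0 ?ltW//.
  by rewrite [Num.sqrt 2 * _]mulrC divfK ?gt_eqF.
have fgE x : x \in `]0, 1[ ->
    f (2 * n%:R + x) = 0 /\ g (2 * n%:R - x) = if x <= h then a n else 0.
  rewrite in_itv/= => /andP[x0 x1]; split.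
    rewrite /f /g (pulse_train_window a h n)//; last lra.
    by rewrite ifF ?oppr0//; lra.
  rewrite /g (pulse_train_window a h n)//; last lra.
  have -> : (2 * n%:R - x <= 2 * n%:R) = true by lra.
  have -> : (2 * n%:R - h <= 2 * n%:R - x) = (x <= h) by apply/idP/idP; lra.
  by rewrite andbT.
apply: (ramp_Xp_norm _ _ _ _ (wave_x f g (2 * n%:R))) => //.
- move=> x; rewrite in_itv/= => x01; rewrite wave_odd//.
  + by rewrite pulse_train_integral//; ring.
  + by move=> ? ? ?; apply: (pulse_train_integrable _ _ c).
- move=> x /fgE[fE gE]; rewrite /wave_x fE gE sub0r mulNr.
  by case: ifP => _; rewrite ?mul0r ?oppr0.
- by move=> x /fgE[fE gE]; rewrite /wave_x /wave_t fE gE sub0r add0r mulNr opprK.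
Qed.

(** The heights follow the recursion by construction; between the pulses the
recursion holds because phi(0) = 0. *)
Lemma pulse_train_solution (Sigma : set (R * R)) (phi : R -> R) p a h c :
  0 < p -> h < 1 -> (forall n, `|a n| <= c) ->
  (forall x, (rotation @` Sigma) (x, phi x)) -> phi 0 = 0 ->
  (forall n, a n.+1 = phi (a n)) ->
  let g := pulse_train a h in
  let f := fun s => - g s in
  solution_from Sigma p (wave f g 0) (wave_t f g 0) (wave f g) f g.
Proof.
move=> p0 h1 ac hphi phi0 aS g f.
have mg (b1 b2 : R) : - 1 <= b1 -> measurable_fun `]b1, b2[ g.
  move=> b11; apply: measurable_funS (measurable_pulse_train a h h1) => //.
  by apply: subset_itv; rewrite bnd_simp.
split=> //.
- split=> T _; apply: (Lp_on_bounded _ _ _ c) => //.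
  + by apply: measurableT_comp => //; apply: mg; lra.
  + by move=> x _; rewrite normrN pulse_train_bounded.
  + exact: mg.
  + by move=> x _; rewrite pulse_train_bounded.
- apply: aeW => t t0; split.
    rewrite wave_odd// ?lexx ?ler01//.
      by rewrite subr0 addr0 set_itv1 Rintegral_set1 mulr0.
    by move=> ? ? ?; apply: (pulse_train_integrable _ _ c).
  have := unrotate _ _ _ (hphi (g (t - 1))).
  have <- : g (t + 1) = phi (g (t - 1)).
    rewrite -(pulse_train_shift a h)//; last lra.
    by congr (pulse_train a h _); lra.
  congr (Sigma (_, _)); rewrite /wave_t /wave_x /f; ring.
- exact: aeW.
Qed.

End Solution.

(** * Slow decay *)

Theorem proposition35 (R : realType) (Sigma : set (R * R)) (p : R)
  (hSigma : damping_set Sigma) (hp : 1 <= p)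
  (hlim : min_quotient xi @[xi --> within Sigma plane_infty] --> (0 : R)%:E) :
  ~ UGAS Sigma p.
Proof.
case=> beta [[_ _ _ beta_decay] beta_bound].
case: hSigma => _ hpos [phi [_ _ hphi]].
have phi_le := graph_norm_le phi Sigma hpos hphi.
have phi0 : phi 0 = 0 by have := phi_le 0; rewrite normr0 normr_le0 => /eqP.
have [_ /cvgrPdist_lt beta0] := beta_decay 1 ltr01.
have [T [_ hT]] := beta0 2^-1 ltac:(by []).
have [N NT] : exists N : nat, T < 2 * N%:R.
  exists (Num.truncn T).+1; apply: lt_le_trans (truncnS_gt T) _.
  by rewrite ler_peMl//; lra.
have := hT _ NT; rewrite /= sub0r normrN => /ltr_normlW betaN.
have [M hM] :=
  iter_norm_ge phi (graph_norm_ge phi Sigma hpos hphi hlim) N 2^-1 ltac:(lra).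
(* The summand 2 gives c > 1, hence the width h below is less than 1. *)
pose c := Num.max 0 M + 2.
have Mmax : 0 <= Num.max 0 M /\ M <= Num.max 0 M by rewrite !le_max !lexx orbT.
have [c2 cM] : 2 <= c /\ M < c by rewrite /c; lra.
have c0 : 0 < c by lra.
have p0 : 0 < p by lra.
(* This width gives the initial pulse of height c the norm 1. *)
pose h := c `^ (- p).
have h0 : 0 < h by exact: powR_gt0.
have h1 : h < 1.
  by rewrite /h powRN invf_lt1 ?powR_gt0// (lt_le_trans _ (le1r_powR _ hp))//; lra.
have ch : c * h `^ p^-1 = 1.
  by rewrite /h -powRrM mulNr mulfV ?gt_eqF// powR_inv1 ?ltW// mulfV// gt_eqF.
pose a n := iter n phi c.
have ac n : `|a n| <= c.
  by elim: n => [|n IH]; [rewrite /a ger0_norm// ltW|exact: le_trans (phi_le _) IH].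
have sol := pulse_train_solution Sigma phi p a h c p0 h1 ac hphi phi0 (fun=> erefl).
have norm n := pulse_train_norm p a h c n hp h0 h1 ac.
have n0 := norm 0%N; have nN := norm N; rewrite /= mulr0 /= in n0 nN sol.
have Xp0 : Xp p (wave (fun s => - pulse_train a h s) (pulse_train a h) 0)
    (wave_t (fun s => - pulse_train a h s) (pulse_train a h) 0).
  by case: n0 => du [? ? _]; split=> //; exists du.
have := beta_bound _ _ _ _ _ Xp0 sol (2 * N%:R) _ _ _ n0 nN.
rewrite {1}/a /= (ger0_norm (ltW c0)) ch => /(_ ltac:(by rewrite mulr_ge0)).
have : 2^-1 <= `|a N| * h `^ p^-1.
  rewrite -[leLHS]mulr1 -[X in _ * X <= _]ch mulrA ler_wpM2r ?powR_ge0//.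
  by have := hM c; rewrite (ger0_norm (ltW c0)) => /(_ cM).
lra.
Qed.
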